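(* Let $L\ge2$ be an integer. For $(a,\varepsilon)$ let $E(m,k;a,\varepsilon,L)=(e_m:g_k)$ be the coefficient of $g_k$ in the expansion of $e_m$ in the basis $\{g_k\}_{k\ge0}$ of $\mathcal F(\varepsilon,L)$, where $e_m$ and $g_k$ are taken with parameters $(a,\varepsilon,L)$. (i) If $m\ge k\ge1$, then $$E(m,k;\tfrac12,1,L)=\frac{2(k+1)(m-1)!(2L-2)(2L-1)(L+m)(2L+m-k-3)!}{(m-k)!(2L+m)!},$$ $$E(m,k;\tfrac12,\tfrac12,L)=\frac{2(k+\frac12)(m-1)!(2L-2)(2L-1)(2L+m-k-3)!}{(m-k)!(2L+m-1)!},$$ $$E(m,k;-\tfrac12,0,L)=\frac{2(m-1)!(2L-2)(2L+m-k-3)!}{(m-k)!(2L+m-2)!}.$$ (ii) If $m\ge1$ and $k=0$, then $$E(m,0;\tfrac12,1,L)=-\frac{2(m+4L-3)(L+m)}{(2L+m)(2L+m-1)(2L+m-2)},$$ $$E(m,0;\tfrac12,\tfrac12,L)=-\frac{2m+6L-5}{(2L+m-1)(2L+m-2)},$$ $$E(m,0;-\tfrac12,0,L)=-\frac{2}{2L+m-2}.$$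
   Context: For real $a>-1$, $\varepsilon\ge0$ and an integer $L\ge2$, let $A_m=L+\varepsilon+m-1$ ($m=1,2,\dots$). $\mathcal F(\varepsilon,L)$ is the vector space of even rational functions $f(t)$ of a complex variable $t$ that are regular at $t=\infty$ and whose only singularities are simple poles contained in $\{\pm A_m:m\ge1\}$. Two bases of this space are $$e_0(t)\equiv1,\qquad e_m(t)=\frac1{t-A_m}-\frac1{t+A_m}\quad(m\ge1),$$ and $$g_k(t)={}_4F_3\left[\begin{matrix}-k,\ k+2\varepsilon,\ L,\ L+a\\ -t+L+\varepsilon,\ t+L+\varepsilon,\ a+1\end{matrix}\,\Big|\,1\right],\quad k=0,1,2,\dots$$ (terminating hypergeometric series, rational functions of $t$). *)

(* Defs.v *)
From HB Require Import structures.
From mathcomp Require Import all_boot all_order all_algebra.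
From mathcomp Require Import fraction complex.
From mathcomp Require Import boolp classical_sets reals.

Set Implicit Arguments.
Unset Strict Implicit.
Unset Printing Implicit Defensive.

Import Order.TTheory GRing.Theory Num.Theory.
Import ComplexField.

Local Open Scope ring_scope.
Local Open Scope complex_scope.
Local Open Scope classical_set_scope.

Notation "x %:F" := (@FracField.tofrac _ x) : ring_scope.

(* Rational functions over the field C are elements of [{fraction {poly C}}]. *)
Notation ratfun C := {fraction {poly C}}.

Definition tvar {C : fieldType} : ratfun C := ('X : {poly C})%:F.
Definition cst {C : fieldType} (c : C) : ratfun C := (c%:P)%:F.

Section RationalFunctions.
Variable C : fieldType.
Implicit Types (f : ratfun C) (p q : {poly C}) (x : C).

(* f(-t) = f(t) *)
Definition even_ratfun f : Prop := exists p q,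
  [/\ q != 0, f = p%:F / q%:F & f = (p \Po (- 'X))%:F / (q \Po (- 'X))%:F].

Definition regular_at f x : Prop := exists p q,
  q.[x] != 0 /\ f = p%:F / q%:F.

Definition regular_at_infinity f : Prop := exists p q,
  [/\ q != 0, (size p <= size q)%N & f = p%:F / q%:F].

Definition at_most_simple_pole f x : Prop :=
  regular_at ((tvar - cst x) * f) x.

(* The sequence c has finite support and f = \sum_k c k * b k. *)
Definition is_expansion (b : nat -> ratfun C) f (c : nat -> C) : Prop :=
  exists n, (forall k, (n <= k)%N -> c k = 0) /\
            f = \sum_(k < n) cst (c k) * b k.

Definition is_basis (V : set (ratfun C)) (b : nat -> ratfun C) : Prop :=
  (forall k, V (b k)) /\ (forall f, V f -> exists! c, is_expansion b f c).

End RationalFunctions.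

(* Coordinates of f \in V in the basis b of V; the null sequence if b is not a *)
(* basis of V or f is not in V.                                                *)
Definition coord {C : fieldType} (V : set (ratfun C))
    (b : nat -> ratfun C) (f : ratfun C) : nat -> C :=
  xget (fun=> 0) [set c | [/\ is_basis V b, V f & is_expansion b f c]].

Definition poch {S : pzSemiRingType} (x : S) (n : nat) : S :=
  \prod_(i < n) (x + i%:R).

(* The hypergeometric series with upper parameters -k :: s, lower parameters r *)
(* and argument z, which terminates at the term of index k.                    *)
Definition hypergeom_terminating {S : fieldType} (k : nat) (s r : seq S) (z : S)
    : S :=
  \sum_(j < k.+1)
    (\prod_(x <- - k%:R :: s) poch x j) / ((\prod_(y <- r) poch y j) * j`!%:R)
    * z ^+ j.

Section SpaceF.
Variable R : realType.
Implicit Types (a eps : R) (L m k : nat).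

(* The real number A_m = L + eps + m - 1 (only m >= 1 matters), seen in R[i]. *)
Definition pole eps L m : R[i] := (L%:R + eps + m%:R - 1)%:C.

Definition spaceF eps L : set (ratfun R[i]) := [set f |
  [/\ even_ratfun f,
      regular_at_infinity f,
      forall x, (forall m, (1 <= m)%N -> x <> pole eps L m /\ x <> - pole eps L m)
        -> regular_at f x
    & forall x, at_most_simple_pole f x]].

Definition e_fun eps L m : ratfun R[i] :=
  if m == 0%N then 1
  else (tvar - cst (pole eps L m))^-1 - (tvar + cst (pole eps L m))^-1.

Definition g_fun a eps L k : ratfun R[i] :=
  hypergeom_terminating k
    [:: k%:R + cst (2 * eps)%:C; L%:R; L%:R + cst a%:C]
    [:: - tvar + L%:R + cst eps%:C; tvar + L%:R + cst eps%:C; cst a%:C + 1]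
    1.

Definition Ecoef m k a eps L : R[i] :=
  coord (spaceF eps L) (g_fun a eps L) (e_fun eps L m) k.

End SpaceF.

(* Main.v *)
(* Put s = t^2 and phi_j = 1 / \prod_(i < j) (A_(i+1)^2 - s). Partial fractions *)
(* show that an even f with the prescribed simple poles, regular at infinity,  *)
(* is a polynomial in s over \prod_(i < N) (A_(i+1)^2 - s) for some N, and     *)
(* peeling off the poles one by one (Newton interpolation at the points A_i^2) *)
(* shows that any triangular combination of the phi_j with nonzero diagonal    *)
(* coefficients, in particular (g_k), is a basis of the space. Telescoping     *)
(* expands e_m in the phi_j, so that e_m = \sum_k c_k g_k becomes one scalar   *)
(* identity for each j <= m. For the three pairs (a, eps), the duplication     *)
(* formula turns (L)_j (L+a)_j and (a+1)_j j! into factorials, and each of     *)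
(* these identities follows from the convolution                               *)
(*   \sum_i 'C(a+i, a) 'C(b+n-i, b) = 'C(a+b+n+1, n).                          *)

Require Import Defs.
From HB Require Import structures.
From mathcomp Require Import all_boot all_order all_algebra.
From mathcomp Require Import fraction complex.
From mathcomp Require Import boolp classical_sets reals.
From mathcomp Require Import ring zify.

Set Implicit Arguments.
Unset Strict Implicit.
Unset Printing Implicit Defensive.

Import Order.TTheory GRing.Theory Num.Theory.
Import ComplexField.
Local Open Scope ring_scope.

(** * Even rational functions with simple poles *)

(** Put [s = t^2], [B i = A_(i+1)] and [P_j = \prod_(i < j) (B i ^+ 2 - s)], which is [pole_prod].
    The space consists exactly of the quotients [Q(s) / P_N] with [Q] of degree at most [N]
    ([even_space_frac], [even_space_pole_prod]). The two lower parameters of [g_k] that contain [t]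
    multiply to [P_j], so [g_k] is a scalar combination of [1/P_0, ..., 1/P_k] whose last
    coefficient is nonzero ([g_funE], [g_coef_neq0]); such a triangular family is a basis
    ([even_space_basis]). On the other side [e_m = -2 A_m / (A_m ^+ 2 - s)], and a telescoping sum
    writes it in the same [1/P_j] ([telescoped_inv], [e_funE]). Comparing coefficients gives one
    scalar equation for each [j <= m]. Since [(-k)_j = 0] for [k < j], equation [j] involves only
    [c_k] with [k >= j]; in particular [c_0] occurs only for [j = 0]. So the formulas for [k >= 1]
    are checked on the equations [j >= 1], and [c_0] is minus the sum of the other coefficients
    ([Ecoef_of_sums]). In the three cases [a] is [1/2] or [-1/2], so the duplication formula turns
    [(L)_j (L+a)_j] and [(a+1)_j j!] into factorials, and [2 eps] is an integer, so [(k + 2 eps)_j]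
    is a quotient of factorials. Each equation becomes a convolution of ratios [(p+i)!/i!]
    ([sum_fact_convolution]), possibly with a linear weight in [i] ([sum_fact_convolution_lin]). *)

Section SqrFrac.
Variable C : fieldType.

Definition sqr_frac (p : {poly C}) : ratfun C := (p \Po 'X^2)%:F.

HB.instance Definition _ := GRing.RMorphism.copy sqr_frac
  (@FracField.tofrac {poly C} \o comp_poly 'X^2).

Lemma sqr_fracM p q : sqr_frac (p * q) = sqr_frac p * sqr_frac q.
Proof. exact: rmorphM. Qed.

Lemma sqr_fracD p q : sqr_frac (p + q) = sqr_frac p + sqr_frac q.
Proof. exact: rmorphD. Qed.

Lemma sqr_fracC c : sqr_frac c%:P = cst c.
Proof. by rewrite /sqr_frac comp_polyC. Qed.

Lemma sqr_frac_eq0 p : (sqr_frac p == 0) = (p == 0).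
Proof. by rewrite /sqr_frac tofrac_eq0 comp_poly_eq0 ?size_polyXn. Qed.

Lemma sqr_frac_inj : injective sqr_frac.
Proof.
by move=> p q /eqP; rewrite -subr_eq0 -rmorphB sqr_frac_eq0 subr_eq0 => /eqP.
Qed.

End SqrFrac.

Section EvenSpace.
Variables (C : numClosedFieldType) (B : nat -> C).
Hypothesis B_neq0 : forall i, B i != 0.
Hypothesis sqB_inj : injective (fun i => B i ^+ 2).

Definition pole_prod k : {poly C} := \prod_(i < k) ((B i ^+ 2)%:P - 'X).

Definition even_space : set (ratfun C) := [set f |
  [/\ even_ratfun f, regular_at_infinity f,
      forall x, (forall i, x <> B i /\ x <> - B i) -> regular_at f x
    & forall x, at_most_simple_pole f x]]%classic.

Lemma size_comp_sqr (p : {poly C}) : (size (p \Po 'X^2) = (size p).*2.-1)%N.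
Proof.
have [->|p0] := eqVneq p 0; first by rewrite comp_poly0 size_poly0.
have s1 : (0 < size p)%N by rewrite size_poly_gt0.
have s2 : (0 < size (p \Po 'X^2))%N.
  by rewrite size_poly_gt0 comp_poly_eq0 ?size_polyXn.
have := size_comp_poly p 'X^2; rewrite size_polyXn /= muln2.
move: s1 s2; case: (size p) => [|n] //; case: (size _) => [|m] // _ _.
by move=> /= ->.
Qed.

Lemma comp_sqr_eq0 (p : {poly C}) : (p \Po 'X^2 == 0) = (p == 0).
Proof. by rewrite comp_poly_eq0 ?size_polyXn. Qed.

Lemma horner_pole_prod k x : (pole_prod k).[x] = \prod_(i < k) (B i ^+ 2 - x).
Proof. by rewrite horner_prod; apply: eq_bigr => i _; rewrite !hornerE. Qed.

Lemma pole_prod_neq0 k : pole_prod k != 0.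
Proof.
apply/prodf_neq0 => i _; rewrite -oppr_eq0 opprB -size_poly_eq0.
by rewrite size_XsubC.
Qed.

Lemma size_pole_prod k : size (pole_prod k) = k.+1.
Proof.
elim: k => [|k IH]; first by rewrite /pole_prod big_ord0 size_poly1.
rewrite /pole_prod big_ord_recr /= -[_ - _]opprB mulrN size_polyN.
rewrite size_mul ?pole_prod_neq0 ?polyXsubC_eq0 // size_XsubC IH; lia.
Qed.

Lemma regular_at_mul (f g : ratfun C) x :
  regular_at f x -> regular_at g x -> regular_at (f * g) x.
Proof.
move=> [p [q [q0 ->]]] [p' [q' [q0' ->]]]; exists (p * p'), (q * q').
by rewrite hornerM mulf_neq0 // !tofracM invfM mulrACA.
Qed.

Lemma even_space_frac k (G : {poly C}) :
  (size G <= k.+1)%N -> even_space (sqr_frac G / sqr_frac (pole_prod k)).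
Proof.
move=> sG; have D0 := pole_prod_neq0 k.
have sqN (p : {poly C}) : (p \Po 'X^2) \Po (- 'X) = p \Po 'X^2.
  by rewrite -comp_polyA rmorphXn /= comp_polyX sqrrN.
have reg x : (forall i, (i < k)%N -> B i ^+ 2 != x ^+ 2) ->
    regular_at (sqr_frac G / sqr_frac (pole_prod k)) x.
  move=> nx; exists (G \Po 'X^2), (pole_prod k \Po 'X^2); split => //.
  rewrite horner_comp horner_pole_prod hornerXn.
  by apply/prodf_neq0 => i _; rewrite subr_eq0 nx.
split.
- exists (G \Po 'X^2), (pole_prod k \Po 'X^2); split => //.
    by rewrite comp_sqr_eq0.
  by rewrite !sqN.
- exists (G \Po 'X^2), (pole_prod k \Po 'X^2); split => //.
    by rewrite comp_sqr_eq0.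
  rewrite !size_comp_sqr size_pole_prod; lia.
- move=> x nx; apply: reg => i _; have [n1 n2] := nx i.
  by apply/eqP => /eqP; rewrite eqf_sqr => /orP[/eqP|/eqP] e;
    [apply: n1 | apply: n2; rewrite e opprK].
- move=> x; have [/existsP[j /eqP ej]|] :=
    boolP [exists j : 'I_k, B j ^+ 2 == x ^+ 2]; last first.
    rewrite negb_exists => /forallP nx.
    apply: regular_at_mul; last by apply: reg => i ik; exact: (nx (Ordinal ik)).
    exists ('X - x%:P), 1; rewrite hornerC oner_neq0; split=> //.
    by rewrite tofrac1 divr1 tofracB.
  (* Here [B j ^+ 2 - t^2 = - (t + x) (t - x)]. Multiplying by [t - x] leaves the denominator
     [- (t + x) r], nonzero at [x] because [B j != 0] and the squares of the [B i] are distinct. *)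
  pose r := \prod_(i < k | i != j) ((B i ^+ 2)%:P - 'X^2 : {poly C}).
  exists (G \Po 'X^2), (- ('X + x%:P) * r); split.
    rewrite hornerM mulf_neq0 //.
      rewrite !hornerE oppr_eq0 -mulr2n mulrn_eq0 /=.
      by rewrite -sqrf_eq0 -ej sqrf_eq0.
    rewrite horner_prod; apply/prodf_neq0 => i ij; rewrite !hornerE -ej.
    by rewrite subr_eq0; apply: contra_neq ij => /sqB_inj/val_inj.
  have -> : sqr_frac (pole_prod k) = ((- ('X + x%:P) * r) * ('X - x%:P))%:F.
    rewrite /sqr_frac /pole_prod rmorph_prod /= (bigD1 j) //= rmorphB /= comp_polyC.
    rewrite comp_polyX ej; congr (_%:F).
    rewrite mulrAC; congr (_ * _).
      by rewrite polyC_exp; ring.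
    by apply: eq_bigr => i _; rewrite rmorphB /= comp_polyC comp_polyX.
  have X0 : (tvar - cst x : ratfun C) != 0.
    by rewrite /tvar /cst -tofracB tofrac_eq0 polyXsubC_eq0.
  rewrite tofracM tofracB -[('X)%:F]/tvar -[(x%:P)%:F]/(cst x) invfM.
  by rewrite [_^-1 * (_ - _)^-1]mulrC mulrCA mulVKf.
Qed.

(** Evenness is given on some fraction [a / b]. Substituting [-t] in [P b = a D] and comparing with
    the cross-multiplied second representation leaves [P(-t) = P(t)]. *)
Lemma even_ratfun_num (P D : {poly C}) : D != 0 -> D \Po (- 'X) = D ->
  even_ratfun (P%:F / D%:F : ratfun C) -> P \Po (- 'X) = P.
Proof.
move=> D0 evD [a [b [b0 e1 e2]]].
have Nneq0 (p : {poly C}) : p != 0 -> p \Po (- 'X) != 0.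
  by move=> p0; rewrite comp_poly_eq0 ?size_polyN ?size_polyX.
have cross (p q r s : {poly C}) : q != 0 -> s != 0 ->
    p%:F / q%:F = r%:F / s%:F :> ratfun C -> p * s = r * q.
  move=> q0 s0 /eqP; rewrite eqr_div ?tofrac_eq0 // -!tofracM.
  by rewrite tofrac_eq => /eqP.
have f1 := cross _ _ _ _ D0 b0 e1.
have f2 := cross _ _ _ _ D0 (Nneq0 _ b0) e2.
apply: (mulIf (Nneq0 _ b0)).
by rewrite f2 -rmorphM f1 rmorphM /= evD.
Qed.

Lemma even_polyE_sqr (P : {poly C}) : P \Po (- 'X) = P ->
  P = even_poly P \Po 'X^2.
Proof.
move=> evP; have evE (p : {poly C}) : (p \Po 'X^2) \Po (- 'X) = p \Po 'X^2.
  by rewrite -comp_polyA rmorphXn /= comp_polyX sqrrN.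
set O := (odd_poly P \Po 'X^2) * 'X.
have e : - O = O.
  apply: (addrI (even_poly P \Po 'X^2)); rewrite poly_even_odd -[RHS]evP.
  rewrite -[P in RHS]poly_even_odd rmorphD rmorphM /= !evE comp_polyX.
  by rewrite mulrN.
have /eqP : O * 2%:R = 0 by rewrite mulr_natr mulr2n -{1}e addNr.
rewrite mulf_eq0 -polyC_natr polyC_eq0 pnatr_eq0 orbF => /eqP odd0.
by rewrite -{1}[P]poly_even_odd -/O odd0 addr0.
Qed.

Lemma uniq_sqfree (r : seq C) :
  (forall x, ~~ (('X - x%:P) ^+ 2 %| \prod_(z <- r) ('X - z%:P))) -> uniq r.
Proof.
elim: r => [|y r IH] //= sqf; rewrite IH ?andbT; last first.
  by move=> x; apply: contra (sqf x) => h; rewrite big_cons dvdp_mull.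
apply: contra (sqf y) => yr; rewrite big_cons expr2 dvdp_mul //.
by rewrite dvdp_XsubCl root_prod_XsubC.
Qed.

(** In lowest terms [f = p / q], regularity confines the roots of [q] to the [B i] and their
    opposites, and simplicity of the poles makes [q] squarefree. Hence [q] divides some [P_N]. Over
    this even denominator the numerator is even, so it is a polynomial in [t^2], and regularity at
    infinity bounds its degree. *)
Lemma even_space_pole_prod f : even_space f ->
  exists N (Q : {poly C}), (size Q <= N.+1)%N /\ f = sqr_frac Q / sqr_frac (pole_prod N).
Proof.
move=> [evf [p0 [q0 [q0n0 spq0 ef0]]] reg pol].
pose g := gcdp p0 q0; pose p := p0 %/ g; pose q := q0 %/ g.
have g0 : g != 0 by rewrite gcdp_eq0 negb_and q0n0 orbT.
have ep : p0 = p * g by rewrite divpK ?dvdp_gcdl.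
have eq : q0 = q * g by rewrite divpK ?dvdp_gcdr.
have q_neq0 : q != 0 by apply: contraNneq q0n0 => e; rewrite eq e mul0r.
have cpq : coprimep p q by rewrite coprimep_div_gcd // q0n0 orbT.
have ef : f = p%:F / q%:F.
  by rewrite ef0 ep eq !tofracM -mulf_div divff ?mulr1 // tofrac_eq0.
have spq : (size p <= size q)%N.
  have [->|p_neq0] := eqVneq p 0; first by rewrite size_poly0.
  move: spq0; rewrite ep eq !size_mul //.
  have : (0 < size g)%N by rewrite size_poly_gt0.
  by case: (size g) => // n _; rewrite !addnS leq_add2r.
clear ef0 spq0 ep eq.
have rootq x : root q x -> exists i, x = B i \/ x = - B i.
  move=> qx; apply: contrapT => nx; have [|u [v [vx]]] := reg x.
    by move=> i; split=> e; apply: nx; exists i; [left | right].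
  have v0 : v != 0 by apply: contraNneq vx => ->; rewrite horner0.
  rewrite ef => /eqP; rewrite eqr_div ?tofrac_eq0 // -!tofracM tofrac_eq.
  move=> /eqP e; move/negP: vx; apply.
  suff /root_dvdp/(_ qx) : q %| v by [].
  by rewrite -(@Gauss_dvdpr _ v p q) ?e ?dvdp_mull // coprimep_sym.
(* A double root of [q] would survive the multiplication by [t - x] and force [x] to be a root of
   [p], against coprimality. *)
have sqf x : ~~ (('X - x%:P) ^+ 2 %| q).
  apply/negP => sq; have [u [v [vx]]] := pol x.
  have v0 : v != 0 by apply: contraNneq vx => ->; rewrite horner0.
  rewrite /tvar /cst -tofracB ef mulrA -tofracM => /eqP.
  rewrite eqr_div ?tofrac_eq0 // -!tofracM tofrac_eq => /eqP e.
  have qx : root q x by rewrite -dvdp_XsubCl (dvdp_trans _ sq) // dvdp_mulr.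
  have : ('X - x%:P) ^+ 2 %| ('X - x%:P) * (p * v).
    by rewrite mulrA e dvdp_mull.
  rewrite expr2 dvdp_mul2l ?polyXsubC_eq0 // dvdp_XsubCl rootM.
  rewrite [root v x](negPf vx) orbF => /(coprimep_root cpq).
  by rewrite -[_ != 0]/(~~ root q x) qx.
have [r er] := closed_field_poly_normal q.
have lq0 : lead_coef q != 0 by rewrite lead_coef_eq0.
have ur : uniq r.
  by apply: uniq_sqfree => x; have := sqf x; rewrite {1}er dvdpZr.
have [N rN] : exists N, forall x, x \in r ->
    exists2 i, (i < N)%N & x = B i \/ x = - B i.
  have : forall x, x \in r -> exists i, x = B i \/ x = - B i.
    move=> x xr; apply: rootq.
    by rewrite er rootZ // root_prod_XsubC.
  elim: (r) => [|y s IH] ys; first by exists 0%N.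
  have [x xs|N HN] := IH; first by apply: ys; rewrite inE xs orbT.
  have [i yi] := ys y (mem_head _ _).
  exists (maxn N i.+1) => x; rewrite inE => /orP[/eqP ->|/HN[j jN xj]].
    by exists i => //; rewrite leq_max ltnSn orbT.
  by exists j => //; rewrite leq_max jN.
pose D := pole_prod N \Po 'X^2.
have D0 : D != 0 by rewrite comp_sqr_eq0 pole_prod_neq0.
have /dvdpP[w ew] : q %| D.
  rewrite er dvdpZl //; apply: uniq_roots_dvdp; last by rewrite uniq_rootsE.
  apply/allP => x /rN[i iN xi]; rewrite rootE horner_comp hornerXn.
  rewrite horner_pole_prod; apply/prodf_eq0.
  by exists (Ordinal iN) => //=; case: xi => ->; rewrite ?sqrrN subrr.
have w0 : w != 0 by apply: contraNneq D0 => e; rewrite ew e mul0r.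
have efD : f = (p * w)%:F / D%:F.
  by rewrite ef ew [w * q]mulrC !tofracM -mulf_div divff ?mulr1 // tofrac_eq0.
have evP : p * w \Po (- 'X) = p * w.
  apply: (@even_ratfun_num _ D) => //; last by rewrite -efD.
  by rewrite -comp_polyA rmorphXn /= comp_polyX sqrrN.
have sP : (size (p * w)%R <= N.*2.+1)%N.
  have -> : N.*2.+1 = size D by rewrite size_comp_sqr size_pole_prod.
  rewrite ew; have [->|p_neq0] := eqVneq p 0; first by rewrite mul0r size_poly0.
  by rewrite !size_mul // addnC -!subn1 leq_sub2r // leq_add2l.
exists N, (even_poly (p * w)); split.
  by rewrite (leq_trans (size_even_poly _)) ?leq_uphalf_double ?(leq_trans sP).
by rewrite efD /sqr_frac -even_polyE_sqr.
Qed.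

(** Newton interpolation: for [k > 0] the value of [G k] at [B k.-1 ^+ 2] is, up to a nonzero
    factor, the residue of [b k] in [s] at its newest pole, so a multiple of [b k] can remove that
    pole. For [k = 0] the numerator is constant and the condition says that it is nonzero. *)
Lemma even_space_basis (b : nat -> ratfun C) (G : nat -> {poly C}) :
  (forall k, b k = sqr_frac (G k) / sqr_frac (pole_prod k)) ->
  (forall k, (size (G k) <= k.+1)%N) ->
  (forall k, (G k).[B k.-1 ^+ 2] != 0) ->
  is_basis even_space b.
Proof.
move=> bE sG G0.
have iD0 k : sqr_frac (pole_prod k) != 0 by rewrite sqr_frac_eq0 pole_prod_neq0.
have pole_prodS k : pole_prod k.+1 = pole_prod k * ((B k ^+ 2)%:P - 'X).
  by rewrite /pole_prod big_ord_recr.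
have span N : forall Q : {poly C}, (size Q <= N.+1)%N -> exists c : nat -> C,
    (forall k, (N.+1 <= k)%N -> c k = 0) /\
    sqr_frac Q / sqr_frac (pole_prod N) = \sum_(k < N.+1) cst (c k) * b k.
  elim: N => [|N IH] Q sQ.
    pose a := Q.[B 0 ^+ 2] / (G 0%N).[B 0 ^+ 2].
    exists (fun k => if k == 0%N then a else 0); split; first by case.
    rewrite big_ord1 /= bE -sqr_fracC mulrA -sqr_fracM; congr (sqr_frac _ / _).
    rewrite mul_polyC (size1_polyC sQ) (size1_polyC (sG 0%N)) -mul_polyC -polyCM.
    congr (_%:P); rewrite /a (size1_polyC sQ) (size1_polyC (sG 0%N)) !hornerC.
    have := G0 0%N; rewrite (size1_polyC (sG 0%N)) !hornerC => g0.
    by rewrite !coefC /= divfK.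
  (* With this multiple of [b N.+1] subtracted, the numerator vanishes at [B N ^+ 2] and the newest
     factor of the denominator cancels. *)
  pose a := Q.[B N ^+ 2] / (G N.+1).[B N ^+ 2].
  have /factor_theorem[Q' eQ'] : root (Q - a *: G N.+1) (B N ^+ 2).
    by rewrite rootE !hornerE divfK ?subrr // G0.
  have sQ' : (size (- Q') <= N.+1)%N.
    rewrite size_polyN; have [->|Q'0] := eqVneq Q' 0; first by rewrite size_poly0.
    have : (size (Q - a *: G N.+1)%R <= N.+2)%N.
      rewrite (leq_trans (size_polyD _ _)) // geq_max sQ size_polyN.
      by rewrite (leq_trans (size_scale_leq _ _)).
    by rewrite eQ' size_mul ?polyXsubC_eq0 // size_XsubC addn2.
  have [c [c0 ec]] := IH _ sQ'.
  exists (fun k => if k == N.+1 then a else c k); split.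
    by move=> k Nk; rewrite gtn_eqF // c0 // ltnW.
  rewrite big_ord_recr /= eqxx.
  under eq_bigr => i _ do rewrite ltn_eqF //.
  rewrite -ec bE -sqr_fracC pole_prodS.
  have -> : Q = a%:P * G N.+1 + (- Q') * ((B N ^+ 2)%:P - 'X).
    by rewrite mul_polyC mulNr -mulrN opprB -eQ' addrC subrK.
  rewrite sqr_fracD !sqr_fracM mulrDl addrC mulrA; congr (_ + _).
  rewrite -mulf_div divff ?mulr1 // sqr_frac_eq0.
  by rewrite -opprB oppr_eq0 polyXsubC_eq0.
have free n : forall c : nat -> C, \sum_(k < n) cst (c k) * b k = 0 ->
    forall k, (k < n)%N -> c k = 0.
  elim: n => [|n IH] c // sum0.
  have cn : c n = 0.
    (* Over the common denominator [pole_prod n], every term but the last keeps the factor that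
       vanishes at [B n.-1 ^+ 2]; evaluation there isolates [c n]. *)
    have : \sum_(k < n.+1)
        (c k)%:P * G k * \prod_(k <= i < n) ((B i ^+ 2)%:P - 'X) = 0.
      apply: sqr_frac_inj; rewrite rmorph0 rmorph_sum /=.
      transitivity (sqr_frac (pole_prod n) * \sum_(k < n.+1) cst (c k) * b k).
        rewrite mulr_sumr; apply: eq_bigr => k _.
        have -> : pole_prod n = pole_prod k * \prod_(k <= i < n) ((B i ^+ 2)%:P - 'X).
          by rewrite /pole_prod -!(big_mkord predT (fun i => (B i ^+ 2)%:P - 'X))
            -big_cat_nat // -ltnS.
        rewrite bE -sqr_fracC !sqr_fracM [RHS]mulrC -!mulrA.
        congr (_ * (_ * _)); rewrite mulKf //.
      by rewrite sum0 mulr0.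
    move/(congr1 (horner^~ (B n.-1 ^+ 2))).
    rewrite big_ord_recr /= big_geq // mulr1 !hornerE horner_sum big1 ?add0r.
      by move/eqP; rewrite mulf_eq0 (negPf (G0 n)) orbF => /eqP.
    move=> k _; rewrite hornerM horner_prod; case: n k {IH sum0} => [[]//|n] k.
    have kn : (k <= n)%N by rewrite -ltnS.
    by rewrite big_nat_recr //= hornerD hornerN hornerC hornerX subrr !mulr0.
  move=> k; rewrite ltnS leq_eqVlt => /orP[/eqP -> //|].
  apply: IH; move: sum0; rewrite big_ord_recr /= cn.
  by rewrite /cst polyC0 tofrac0 mul0r addr0.
split=> [k|f /even_space_pole_prod[N [Q [sQ ->]]]].
  by rewrite bE; exact: even_space_frac.
have [c [c0 ec]] := span _ _ sQ.
exists c; split; first by exists N.+1.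
move=> c' [n [c'0 ec']]; apply/funext => k.
(* A common length for both expansions, which also covers the index [k] to be compared. *)
pose M := (maxn k.+1 (maxn n N.+1)).
have widen m (d : nat -> C) : (m <= M)%N -> (forall k, (m <= k)%N -> d k = 0) ->
    \sum_(k < m) cst (d k) * b k = \sum_(k < M) cst (d k) * b k.
  move=> mM d0; rewrite (big_ord_widen _ (fun k => cst (d k) * b k) mM).
  rewrite big_mkcond; apply: eq_bigr => i _; case: ltnP => // /d0 ->.
  by rewrite /cst polyC0 tofrac0 mul0r.
apply/eqP; rewrite -subr_eq0; apply/eqP.
apply: (free M (fun k => c k - c' k)); last by rewrite leq_maxl.
rewrite -[RHS](subrr (sqr_frac Q / sqr_frac (pole_prod N))).
rewrite {1}ec ec' (widen N.+1) ?(widen n) ?leq_max ?leqnn ?orbT // -sumrB.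
by apply: eq_bigr => i _; rewrite /cst polyCB tofracB mulrBl.
Qed.

End EvenSpace.

(** * Factorial sums *)

Lemma sum_ord_shift (V : nmodType) (f : nat -> V) j N :
  (forall k, (k < j)%N -> f k = 0) ->
  \sum_(k < (j + N).+1) f k = \sum_(i < N.+1) f (j + i)%N.
Proof.
move=> f0; rewrite -(big_mkord xpredT f) (@big_cat_nat _ _ _ j) //=; last first.
  by rewrite leqW ?leq_addr.
rewrite big_nat_cond big1 ?add0r; last by move=> k /andP[/andP[_ /f0]].
rewrite -{1}[j]add0n big_addn -addnS addKn big_mkord.
by apply: eq_bigr => i _; rewrite addnC.
Qed.

Lemma sum_ord_tail (V : zmodType) (f : nat -> V) n :
  \sum_(i < n.+1) f i.+1 = \sum_(k < n.+2) f k - f 0%N.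
Proof.
rewrite [in RHS]big_ord_recl addrAC subrr add0r.
by apply: eq_bigr => i _; rewrite lift0.
Qed.

(** These are the coefficients of [x^n] in [(1-x)^-(a+1) (1-x)^-(b+1) = (1-x)^-(a+b+2)]. The proof
    is a double induction, on [a] and then on [n], with Pascal's rule. *)
Lemma bin_convolution a b n :
  (\sum_(i < n.+1) 'C(a + i, a) * 'C(b + (n - i), b) = 'C((a + b + n).+1, n))%N.
Proof.
elim: a n => [|a IHa].
  elim=> [|n IHn]; first by rewrite big_ord1 !addn0 !binn bin0.
  rewrite big_ord_recl subn0.
  under eq_bigr => i _ do rewrite bin0 -(bin0 i) lift0 subSS.
  rewrite IHn !add0n addnS binS bin0 mul1n; congr (_ + _)%N.
  have -> : n.+1 = ((b + n).+1 - b)%N by lia.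
  by rewrite bin_sub //; lia.
elim=> [|n IHn]; first by rewrite big_ord1 !addn0 !binn bin0.
rewrite big_ord_recl subn0.
under eq_bigr => i _ do
  rewrite lift0 subSS addnS addSn binS mulnDl -[(a + i).+1]/(a.+1 + i)%N.
rewrite big_split /= IHn.
have -> : (a.+1 + b + n = a + b + n.+1)%N by lia.
have -> : (a.+1 + b + n.+1 = (a + b + n.+1).+1)%N by lia.
rewrite binS [RHS]addnC -IHa.
rewrite [in RHS]big_ord_recl subn0 addn0 !binn addnCA; congr (_ + (_ + _))%N.
  by rewrite addn0 binn.
by apply: eq_bigr => i _; rewrite lift0 subSS -addSnnS.
Qed.

Section FactorialSums.
Variable F : numFieldType.

Lemma factr_neq0 n : n`!%:R != 0 :> F.
Proof. by rewrite pnatr_eq0 -lt0n fact_gt0. Qed.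

Lemma factSr n : n.+1`!%:R = n.+1%:R * n`!%:R :> F.
Proof. by rewrite factS natrM. Qed.

Lemma binr_fact m k : (k <= m)%N ->
  'C(m, k)%:R * (k`!%:R * (m - k)`!%:R) = m`!%:R :> F.
Proof. by move=> km; rewrite -!natrM bin_fact. Qed.

Lemma sum_fact_convolution a b n :
  \sum_(i < n.+1) (a + i)`!%:R / i`!%:R * ((b + (n - i))`!%:R / (n - i)`!%:R)
  = a`!%:R * b`!%:R * (a + b + n).+1`!%:R / (n`!%:R * (a + b).+1`!%:R) :> F.
Proof.
have binE p i : (p + i)`!%:R / i`!%:R = 'C(p + i, p)%:R * p`!%:R :> F.
  apply: (mulIf (factr_neq0 i)); rewrite divfK ?factr_neq0 //.
  by rewrite -(binr_fact (leq_addr i p)) addKn mulrA.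
transitivity (a`!%:R * b`!%:R * 'C((a + b + n).+1, n)%:R : F).
  rewrite -bin_convolution natr_sum mulr_sumr; apply: eq_bigr => i _.
  by rewrite !binE natrM; ring.
have nm : (n <= (a + b + n).+1)%N by rewrite leqW ?leq_addl.
rewrite -(binr_fact nm) subSn ?leq_addl // addnK [_ * (_ * (_ * _))]mulrA mulfK //.
by rewrite mulf_neq0 ?factr_neq0.
Qed.

(** The weight [2 i + a + 1] splits as [(a + 1 + i) + i]. The first part raises [a] by one; so does
    the second after a shift of [i], with [n] lowered by one. Two plain convolutions remain. *)
Lemma sum_fact_convolution_lin a b n :
  \sum_(i < n.+1) (i%:R *+ 2 + a.+1%:R) * (a + i)`!%:R / i`!%:R
     * ((b + (n - i))`!%:R / (n - i)`!%:R)
  = a.+1`!%:R * b`!%:R * (a + b + n).+1`!%:R * (a%:R + b%:R + n%:R *+ 2 + 2)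
     / (n`!%:R * (a + b).+2`!%:R) :> F.
Proof.
pose u n i : F := (b + (n - i))`!%:R / (n - i)`!%:R.
transitivity (\sum_(i < n.+1) (a.+1 + i)`!%:R / i`!%:R * u n i +
   \sum_(i < n.+1) i%:R * (a + i)`!%:R / i`!%:R * u n i).
  rewrite -big_split; apply: eq_bigr => i _ /=.
  rewrite -/(u n i); move: (u n i) => v.
  have -> : (a.+1 + i)`!%:R = (a.+1%:R + i%:R) * (a + i)`!%:R :> F.
    by rewrite addSn factSr -natrD addSn.
  by ring.
rewrite sum_fact_convolution; case: n => [|n].
  rewrite big_ord1 !mul0r addr0 !addn0 mul0rn addr0 !addSn !fact0.
  rewrite (factSr (a + b).+1) -[in RHS]natrD -[in RHS]natrD addn2.
  have : (a + b).+2%:R != 0 :> F by rewrite pnatr_eq0.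
  move: (factr_neq0 (a + b).+1); move: (_ `!%:R) (_.+2%:R) => x y hx hy.
  by field; rewrite hx hy.
rewrite big_ord_recl !mul0r add0r.
have -> : \sum_(i < n.+1) (lift ord0 i)%:R * (a + lift ord0 i)`!%:R /
      (lift ord0 i)`!%:R * u n.+1 (lift ord0 i) =
    \sum_(i < n.+1) (a.+1 + i)`!%:R / i`!%:R * u n i.
  apply: eq_bigr => i _; rewrite lift0 /u subSS addnS -addSn (factSr i).
  by rewrite -mulf_div divff ?mul1r ?pnatr_eq0.
rewrite sum_fact_convolution.
have -> : (a.+1 + b + n.+1 = (a + b + n).+2)%N by lia.
have -> : (a.+1 + b + n = (a + b + n).+1)%N by lia.
rewrite addSn addnS (factSr (a + b + n).+2) (factSr n).
have -> : (a + b + n).+3%:R = a%:R + b%:R + n%:R + 3 :> F.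
  by rewrite -!natrD addn3.
have n1 : n.+1%:R = n%:R + 1 :> F by rewrite -addn1 natrD.
have : n%:R + 1 != 0 :> F by rewrite -n1 pnatr_eq0.
move: (factr_neq0 n) (factr_neq0 (a + b).+2); rewrite n1.
move: (_ `!%:R) (_ `!%:R) => x y hx hy hn.
by field; rewrite hx hy hn.
Qed.

(** * Pochhammer symbols as quotients of factorials, and the duplication formula *)

Lemma pochS (x : F) n : poch x n.+1 = poch x n * (x + n%:R).
Proof. by rewrite /poch big_ord_recr. Qed.

Lemma poch0 (x : F) : poch x 0 = 1.
Proof. by rewrite /poch big_ord0. Qed.

Lemma pochSl (x : F) n : poch x n.+1 = x * poch (x + 1) n.
Proof.
rewrite /poch big_ord_recl /= addr0; congr (_ * _).
by apply: eq_bigr => i _; rewrite /bump /= natrD addrA.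
Qed.

Lemma poch_natS n j : poch n.+1%:R j = (n + j)`!%:R / n`!%:R :> F.
Proof.
apply: (mulIf (factr_neq0 n)); rewrite divfK ?factr_neq0 //.
elim: j => [|j IH]; first by rewrite poch0 mul1r addn0.
by rewrite pochS mulrAC IH addnS factSr mulrC -natrD addSn.
Qed.

Lemma poch_oppn_lt k j : (k < j)%N -> poch (- k%:R) j = 0 :> F.
Proof.
move=> kj; rewrite /poch (bigD1 (Ordinal kj)) //=.
by rewrite addNr mul0r.
Qed.

Lemma poch_oppn i j :
  poch (- (j + i)%:R) j = (-1) ^+ j * (j + i)`!%:R / i`!%:R :> F.
Proof.
elim: j => [|j IH]; first by rewrite poch0 expr0 mul1r divff ?factr_neq0.
rewrite pochSl addSn.
have -> : - (j + i).+1%:R + 1 = - (j + i)%:R :> F.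
  by rewrite -addn1 natrD; ring.
by rewrite IH factSr exprS; ring.
Qed.

Lemma poch_duplication (x : F) j :
  poch x j * poch (x + 1 / 2) j * 4 ^+ j = poch (2 * x) j.*2.
Proof.
elim: j => [|j IH]; first by rewrite !poch0 !mulr1.
rewrite doubleS !pochS -IH exprS -muln2 -[(_ * _).+1]addn1 natrD natrM.
by field.
Qed.

End FactorialSums.

(** After [p] terms the remainder is the product of the [x i - x n] for [i < p] over the product of
    the [x i] times [x n]; at [p = n + 1] it contains the factor [x n - x n]. With
    [x i = B i ^+ 2 - t^2] the differences no longer contain [t]. *)
Lemma telescoped_inv (K : fieldType) (x : nat -> K) n :
  (forall i, x i != 0) ->
  (x n)^-1 =
    \sum_(j < n.+1) (\prod_(i < j) (x i - x n)) / \prod_(i < j.+1) x i.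
Proof.
move=> x0; have P0 p : \prod_(i < p) x i != 0 by apply/prodf_neq0.
suff partial p : (x n)^-1 =
    \sum_(j < p) (\prod_(i < j) (x i - x n)) / \prod_(i < j.+1) x i
    + (\prod_(i < p) (x i - x n)) / (\prod_(i < p) x i * x n).
  by rewrite {1}(partial n.+1) [X in _ + X / _]big_ord_recr /= subrr mulr0 mul0r addr0.
elim: p => [|p {1}->]; first by rewrite !big_ord0 add0r !mul1r.
rewrite big_ord_recr -addrA /=; congr (_ + _).
rewrite !big_ord_recr /=.
have h := P0 p; have h1 := x0 p; have h2 := x0 n.
by field; rewrite h h1 h2.
Qed.

(** * The expansion of e_m in the basis (g_k) *)

Lemma poch_rmorph (S T : pzRingType) (f : {rmorphism S -> T}) x n :
  f (poch x n) = poch (f x) n.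
Proof.
by rewrite /poch rmorph_prod; apply: eq_bigr => i _; rewrite rmorphD rmorph_nat.
Qed.

Lemma coord_unique (C : fieldType) (V : set (ratfun C)) b f c :
  is_basis V b -> V f -> is_expansion b f c -> Defs.coord V b f = c.
Proof.
move=> bV Vf fc; apply: xget_unique => // c' [_ _ fc'].
by have [d [_ du]] := bV.2 _ Vf; rewrite -(du _ fc') -(du _ fc).
Qed.

HB.instance Definition _ (C : fieldType) := GRing.RMorphism.copy (@cst C)
  (@FracField.tofrac {poly C} \o polyC).

(** Factor by factor, [(-t + u)(t + u) = u^2 - t^2] merges the two lower parameters that contain
    [t]. The rest is scalar and is the image under [f] of an element of [F]. *)
Lemma hypergeom_g_expansion (F K : fieldType) (f : {rmorphism F -> K}) (t : K)
    (a eps e2 : F) (L k : nat) :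
  hypergeom_terminating k [:: k%:R + f e2; L%:R; L%:R + f a]
    [:: - t + L%:R + f eps; t + L%:R + f eps; f a + 1] 1 =
  \sum_(j < k.+1)
    f (poch (- k%:R) j * poch (k%:R + e2) j * poch L%:R j * poch (L%:R + a) j
       / (poch (a + 1) j * j`!%:R))
    / \prod_(i < j) (f (L%:R + eps + i%:R) ^+ 2 - t ^+ 2).
Proof.
rewrite /hypergeom_terminating; apply: eq_bigr => j _.
rewrite expr1n mulr1 !big_cons !big_nil !mulr1.
have -> : \prod_(i < j) (f (L%:R + eps + i%:R) ^+ 2 - t ^+ 2) =
    poch (- t + L%:R + f eps) j * poch (t + L%:R + f eps) j.
  rewrite /poch -big_split /=; apply: eq_bigr => i _.
  by rewrite !rmorphD !rmorph_nat; ring.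
rewrite fmorph_div !rmorphM !poch_rmorph rmorphN !rmorphD !rmorph_nat rmorph1.
by rewrite -!mulrA; do 4 congr (_ * _); rewrite -!invfM; congr (_^-1); ring.
Qed.

Lemma subr_inv_sqr (K : fieldType) (t b : K) : b ^+ 2 - t ^+ 2 != 0 ->
  (t - b)^-1 - (t + b)^-1 = - (2 * b) / (b ^+ 2 - t ^+ 2).
Proof.
rewrite subr_sqr mulf_eq0 negb_or => /andP[h1 h2].
have h3 : t - b != 0 by rewrite -opprB oppr_eq0.
have h4 : t + b != 0 by rewrite addrC.
by field; rewrite ?h1 ?h2 ?h3 ?h4.
Qed.

Section NewtonForm.
Variables (C : numClosedFieldType) (B : nat -> C).

(** The numerator of the sum of the [d j / P_j] for [j <= k] over the common denominator [P_k]. *)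
Definition newton_num (d : nat -> C) k : {poly C} :=
  \sum_(j < k.+1) (d j)%:P * \prod_(j <= i < k) ((B i ^+ 2)%:P - 'X).

Lemma pole_prod_split j k : (j <= k)%N ->
  pole_prod B k = pole_prod B j * \prod_(j <= i < k) ((B i ^+ 2)%:P - 'X).
Proof.
move=> jk; rewrite /pole_prod.
rewrite -!(big_mkord predT (fun i => (B i ^+ 2)%:P - 'X)).
by rewrite -big_cat_nat.
Qed.

Lemma newton_numE d k :
  sqr_frac (newton_num d k) / sqr_frac (pole_prod B k) =
  \sum_(j < k.+1) cst (d j) / sqr_frac (pole_prod B j).
Proof.
rewrite rmorph_sum /= mulr_suml; apply: eq_bigr => j _.
have jk : (j <= k)%N by rewrite -ltnS.
rewrite sqr_fracM sqr_fracC (pole_prod_split jk) sqr_fracM -mulf_div divff ?mulr1 //.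
rewrite sqr_frac_eq0; move: (pole_prod_neq0 B k).
by rewrite (pole_prod_split jk) mulf_eq0 negb_or => /andP[].
Qed.

Lemma size_newton_num d k : (size (newton_num d k) <= k.+1)%N.
Proof.
apply: (leq_trans (size_sum _ _ _)); apply/bigmax_leqP => j _.
have jk : (j <= k)%N by rewrite -ltnS.
rewrite mul_polyC (leq_trans (size_scale_leq _ _)) //.
have := size_pole_prod B k; rewrite (pole_prod_split jk) => e.
have := pole_prod_neq0 B k; rewrite (pole_prod_split jk) mulf_eq0 negb_or.
move=> /andP[n1 n2]; move: e; rewrite size_mul // size_pole_prod addSn /= => e.
exact: leq_trans (leq_addl j _) (eq_leq e).
Qed.

Lemma horner_newton_num d k : (newton_num d k).[B k.-1 ^+ 2] = d k.
Proof.
rewrite /newton_num big_ord_recr /= big_geq // mulr1 hornerD hornerC.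
rewrite horner_sum big1 ?add0r // => j _.
rewrite hornerM horner_prod; case: k j => [[]//|n] j.
have jn : (j <= n)%N by rewrite -ltnS.
by rewrite big_nat_recr //= hornerD hornerN !hornerC hornerX subrr !mulr0.
Qed.

End NewtonForm.

Section Expansion.
Local Open Scope complex_scope.
Variables (R : realType) (a eps : R) (L : nat).
Hypotheses (a1 : -1 < a) (eps0 : 0 <= eps) (L1 : (1 <= L)%N).

Let B i : R[i] := pole eps L i.+1.

Lemma pole_gt0 i : 0 < L%:R + eps + i.+1%:R - 1.
Proof.
by rewrite -natr1 addrA addrK ltr_wpDr ?ler0n // ltr_wpDr // ltr0n.
Qed.

Lemma poleSE i : B i = L%:R + eps%:C + i%:R.
Proof. by rewrite /B /pole -natr1 addrA addrK !rmorphD !rmorph_nat. Qed.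

Lemma pole_neq0 i : B i != 0.
Proof. by rewrite /B /pole fmorph_eq0 gt_eqF // pole_gt0. Qed.

Lemma sqr_pole_inj : injective (fun i => B i ^+ 2).
Proof.
move=> i j /eqP; rewrite -!rmorphXn /= (inj_eq (fmorph_inj _)).
rewrite eqrXn2 ?ltW ?pole_gt0 // => /eqP.
by move=> /addIr/addrI/eqP; rewrite eqr_nat => /eqP [].
Qed.

Lemma spaceF_even_space : spaceF eps L = even_space B.
Proof.
apply/funext => f; apply/propext; split=> -[e i reg s]; split=> // x nx;
  apply: reg; first by move=> [|m] // _; exact: nx.
by move=> m; exact: nx.
Qed.

Definition g_coef k j : R[i] :=
  poch (- k%:R) j * poch (k%:R + 2 * eps%:C) j * poch L%:R j
    * poch (L%:R + a%:C) j / (poch (a%:C + 1) j * j`!%:R).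

Lemma poch_real_neq0 (x : R) j : 0 < x -> poch (x%:C : R[i]) j != 0.
Proof.
move=> x0; apply/prodf_neq0 => i _.
by rewrite -(rmorph_nat (real_complex R)) -rmorphD fmorph_eq0 gt_eqF ?ltr_pwDl.
Qed.

Lemma poch_a1_neq0 j : poch (a%:C + 1) j != 0 :> R[i].
Proof.
rewrite -(rmorph1 (real_complex R)) -rmorphD poch_real_neq0 //.
by rewrite -ltrBlDr sub0r.
Qed.

Lemma g_coef_lt k j : (k < j)%N -> g_coef k j = 0.
Proof. by move=> kj; rewrite /g_coef poch_oppn_lt // !mul0r. Qed.

Lemma g_coef_neq0 k : g_coef k k != 0.
Proof.
have nC n : n%:R = (n%:R : R)%:C :> R[i] by rewrite rmorph_nat.
have L0 : 0 < L%:R :> R by rewrite ltr0n.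
have a0 : 0 < a + 1 by rewrite -ltrBlDr sub0r.
rewrite /g_coef !mulf_neq0 //.
- rewrite -{1}[k]addn0 poch_oppn mulf_neq0 ?mulf_neq0 ?invr_eq0 ?factr_neq0 //.
  by rewrite signr_eq0.
(* For [eps = 0] the base [k + 2 eps] vanishes at [k = 0], but there the product is empty. *)
- case: k => [|k]; first by rewrite poch0 oner_neq0.
  rewrite nC -(rmorph_nat (real_complex R) 2) -rmorphM -rmorphD /=.
  apply: poch_real_neq0; rewrite ltr_pwDl ?ltr0n // mulr_ge0 ?ler0n //.
- by rewrite nC poch_real_neq0.
- rewrite nC -rmorphD poch_real_neq0 // (lt_le_trans a0) //.
  by rewrite addrC lerD2r ler1n.
by rewrite invr_eq0 mulf_neq0 ?factr_neq0 ?poch_a1_neq0.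
Qed.

Lemma pole_prodE j : sqr_frac (pole_prod B j) =
  \prod_(i < j) (cst (L%:R + eps%:C + i%:R) ^+ 2 - tvar ^+ 2).
Proof.
rewrite /pole_prod rmorph_prod; apply: eq_bigr => i _.
rewrite rmorphB /= sqr_fracC rmorphXn poleSE; congr (_ - _).
by rewrite /sqr_frac comp_polyX tofracXn.
Qed.

Lemma g_funE k : g_fun a eps L k =
  \sum_(j < k.+1) cst (g_coef k j) / sqr_frac (pole_prod B j).
Proof.
rewrite /g_fun (hypergeom_g_expansion (@cst R[i])).
apply: eq_bigr => j _; rewrite pole_prodE.
have -> // : (2 * eps)%:C = 2 * eps%:C by rewrite rmorphM rmorph_nat.
Qed.

Lemma g_fun_basis : is_basis (spaceF eps L) (g_fun a eps L).
Proof.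
rewrite spaceF_even_space.
apply: (@even_space_basis _ _ pole_neq0 sqr_pole_inj _
  (fun k => newton_num B (g_coef k) k)) => k.
- by rewrite g_funE newton_numE.
- exact: size_newton_num.
by rewrite horner_newton_num g_coef_neq0.
Qed.

(** The two Pochhammer symbols come from [B i ^+ 2 - B n ^+ 2 = (i - n) (2 L + 2 eps + n + i)]. The
    telescoped sum starts at the denominator [P_1], hence the shift and the value 0 at [j = 0]. *)
Definition e_coef n j : R[i] := if j is j'.+1 then
    - (2 * (L%:R + eps%:C + n%:R) * poch (- n%:R) j'
       * poch (2 * L%:R + 2 * eps%:C + n%:R) j')
  else 0.

Lemma e_funE n : e_fun eps L n.+1 =
  \sum_(j < n.+2) cst (e_coef n j) / sqr_frac (pole_prod B j).
Proof.
rewrite big_ord_recl /= rmorph0 mul0r add0r.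
pose x i : ratfun R[i] := cst (B i) ^+ 2 - tvar ^+ 2.
have xE i : sqr_frac ((B i ^+ 2)%:P - 'X) = x i.
  rewrite rmorphB /= sqr_fracC rmorphXn; congr (_ - _).
  by rewrite /sqr_frac comp_polyX tofracXn.
have x0 i : x i != 0.
  by rewrite -xE sqr_frac_eq0 -oppr_eq0 opprB polyXsubC_eq0.
rewrite /e_fun /= -/(B n) subr_inv_sqr; last exact: x0.
rewrite -/(x n) (telescoped_inv n x0) mulr_sumr; apply: eq_bigr => j _.
rewrite mulrA; congr (_ / _); last first.
  by rewrite rmorph_prod; apply: eq_bigr => i _; rewrite -xE.
have -> : \prod_(i < j) (x i - x n) = cst (poch (- n%:R) j
    * poch (2 * L%:R + 2 * eps%:C + n%:R) j).
  rewrite /poch -big_split rmorph_prod; apply: eq_bigr => i _ /=.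
  rewrite /x opprB addrA subrK -!(rmorphXn (@cst R[i])).
  rewrite -(rmorphB (@cst R[i])); congr (cst _).
  by rewrite !poleSE; ring.
rewrite -(rmorph_nat (@cst R[i]) 2) -(rmorphM (@cst R[i])) -(rmorphN (@cst R[i])).
rewrite -(rmorphM (@cst R[i])).
by congr (cst _); rewrite poleSE /= -mulrA mulNr.
Qed.

(** The hypothesis is the equality of the coefficients of [1/P_j], multiplied by [(a+1)_j j!], the
    part of the denominator of [g_coef] that does not depend on [k]. *)
Lemma Ecoef_unique n (c : nat -> R[i]) :
  (forall j, (j <= n.+1)%N ->
    (\sum_(k < n.+2) c k * (poch (- k%:R) j * poch (k%:R + 2 * eps%:C) j))
      * (poch L%:R j * poch (L%:R + a%:C) j)
    = e_coef n j * (poch (a%:C + 1) j * j`!%:R)) ->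
  forall k, (k <= n.+1)%N -> Ecoef n.+1 k a eps L = c k.
Proof.
move=> H k kn; rewrite /Ecoef.
(* An expansion has finite support, so [c] is cut off after [n + 1]. *)
rewrite (@coord_unique _ _ _ _ (fun k => if (k <= n.+1)%N then c k else 0)).
- by rewrite kn.
- exact: g_fun_basis.
- rewrite spaceF_even_space e_funE -newton_numE.
  apply: even_space_frac; first exact: pole_neq0.
    exact: sqr_pole_inj.
  exact: size_newton_num.
exists n.+2; split; first by move=> i ni; rewrite leqNgt ni.
rewrite e_funE.
transitivity (\sum_(k < n.+2) \sum_(j < n.+2)
   cst (c k) * (cst (g_coef k j) / sqr_frac (pole_prod B j))).
  rewrite exchange_big /=; apply: eq_bigr => j _.
  under eq_bigr do rewrite mulrA -rmorphM.
  rewrite -!mulr_suml; congr (_ * _).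
  rewrite -rmorph_sum; congr (cst _).
  have w0 : poch (a%:C + 1) j * j`!%:R != 0 :> R[i].
    by rewrite mulf_neq0 ?factr_neq0 ?poch_a1_neq0.
  apply: (mulIf w0); rewrite -H; last by rewrite -ltnS.
  rewrite !mulr_suml; apply: eq_bigr => i _.
  by rewrite /g_coef -[RHS]mulrA divfK // !mulrA.
apply: eq_bigr => i _; rewrite -ltnS ltn_ord -mulr_sumr; congr (_ * _).
rewrite g_funE (big_ord_widen _
  (fun j => cst (g_coef i j) / sqr_frac (pole_prod B j)) (ltn_ord i)).
rewrite [RHS]big_mkcond; apply: eq_bigr => j _; case: ltnP => // ij.
by rewrite g_coef_lt // /cst polyC0 tofrac0 mul0r.
Qed.

(** For [j = J + 1] the terms with [k < j] vanish, so the sum runs over [k = J + 1 + i] and [c0]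
    drops out; the equation [j = 0] is the first hypothesis. *)
Lemma Ecoef_of_sums n (c0 : R[i]) (y : nat -> R[i]) :
  c0 + \sum_(i < n.+1) y i.+1 = 0 ->
  (forall J N, n = (J + N)%N ->
    (\sum_(i < N.+1) y (J.+1 + i)%N *
        (poch (- (J.+1 + i)%:R) J.+1 *
         poch ((J.+1 + i)%:R + 2 * eps%:C) J.+1))
      * (poch L%:R J.+1 * poch (L%:R + a%:C) J.+1)
    = - (2 * (L%:R + eps%:C + n%:R) * poch (- n%:R) J
         * poch (2 * L%:R + 2 * eps%:C + n%:R) J)
      * (poch (a%:C + 1) J.+1 * J.+1`!%:R)) ->
  Ecoef n.+1 0 a eps L = c0 /\
  forall k, (1 <= k <= n.+1)%N -> Ecoef n.+1 k a eps L = y k.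
Proof.
move=> H0 H; pose c k := if k == 0%N then c0 else y k.
suff E k : (k <= n.+1)%N -> Ecoef n.+1 k a eps L = c k.
  by split=> [|[|k] // /andP[_ /E]] //; rewrite E.
apply: Ecoef_unique => -[_|J Jn].
  rewrite /e_coef !poch0 !mulr1 ?mul0r -[RHS]H0 big_ord_recl.
  rewrite /c /= !poch0 !mulr1; congr (_ + _).
  by apply: eq_bigr => i _; rewrite !poch0 !mulr1.
have eN : n = (J + (n - J))%N by rewrite subnKC.
rewrite /e_coef -(H _ _ eN); congr (_ * _).
transitivity (\sum_(k < (J.+1 + (n - J)).+1)
   c k * (poch (- k%:R) J.+1 * poch (k%:R + 2 * eps%:C) J.+1)).
  by rewrite addSn -eN.
rewrite (sum_ord_shift (f := fun k =>
  c k * (poch (- k%:R) J.+1 * poch (k%:R + 2 * eps%:C) J.+1))) //.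
by move=> i iJ; rewrite poch_oppn_lt // mul0r mulr0.
Qed.

End Expansion.

(** * The three pairs of parameters *)

Section ThreeCases.
Variable F : numFieldType.

Lemma expr4_neq0 j : 4 ^+ j != 0 :> F.
Proof. by rewrite expf_neq0 ?pnatr_eq0. Qed.

Lemma poch_half_pair (x : F) n j : 2 * x = n.+1%:R ->
  poch x j * poch (x + 1 / 2) j = (n + 2 * j)`!%:R / n`!%:R / 4 ^+ j.
Proof.
move=> xn; apply: (mulIf (expr4_neq0 j)); rewrite divfK ?expr4_neq0 //.
by rewrite poch_duplication xn poch_natS mul2n.
Qed.

(* The suffix of the names [dual_coef*] is the value of eps. *)
Definition dual_coef1 L m k : F := 2 * (k%:R + 1) * (m - 1)`!%:R * (2 * L%:R - 2)
  * (2 * L%:R - 1) * (L%:R + m%:R) * (2 * L + m - k - 3)`!%:R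
          / ((m - k)`!%:R * (2 * L + m)`!%:R).

Definition dual_coef_half L m k : F := 2 * (k%:R + 1 / 2) * (m - 1)`!%:R * (2 * L%:R - 2)
  * (2 * L%:R - 1) * (2 * L + m - k - 3)`!%:R
          / ((m - k)`!%:R * (2 * L + m - 1)`!%:R).

Definition dual_coef0 L m k : F :=
  2 * (m - 1)`!%:R * (2 * L%:R - 2) * (2 * L + m - k - 3)`!%:R
          / ((m - k)`!%:R * (2 * L + m - 2)`!%:R).

(** With [L = l + 2] and [k = J + 1 + i], one has [(k + 1) (k + 2)_(J+1) = (k + J + 2)!/k!], and
    this [k!] cancels the one in [(-k)_(J+1)]. A plain convolution remains; [K] collects the factors
    free of [i]. *)
Lemma dual_coef1_sum l J N :
  (\sum_(i < N.+1) dual_coef1 l.+2 (J + N).+1 (J.+1 + i)%N *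
        (poch (- (J.+1 + i)%:R) J.+1 *
         poch ((J.+1 + i)%:R + 2 * 1) J.+1))
      * (poch l.+2%:R J.+1 * poch (l.+2%:R + 1 / 2) J.+1)
    = - (2 * (l.+2%:R + 1 + (J + N)%:R) * poch (- (J + N)%:R) J
         * poch (2 * l.+2%:R + 2 * 1 + (J + N)%:R) J)
      * (poch (1 / 2 + 1) J.+1 * J.+1`!%:R).
Proof.
pose K : F := 2 * (J + N)`!%:R * (2 * l.+2%:R - 2) * (2 * l.+2%:R - 1)
  * (l.+2%:R + (J + N).+1%:R) / (2 * l + 5 + J + N)`!%:R * (-1) ^+ J.+1.
transitivity (K * (\sum_(i < N.+1) (2 * J + 3 + i)`!%:R / i`!%:R *
    ((2 * l + 1 + (N - i))`!%:R / (N - i)`!%:R)) *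
   (poch l.+2%:R J.+1 * poch (l.+2%:R + 1 / 2) J.+1)).
  congr (_ * _); rewrite mulr_sumr; apply: eq_bigr => i _.
  have iN : (i <= N)%N by rewrite -ltnS.
  rewrite /dual_coef1 poch_oppn.
  have -> : ((J + N).+1 - 1 = J + N)%N by lia.
  have -> : (2 * l.+2 + (J + N).+1 - (J.+1 + i) - 3 = 2 * l + 1 + (N - i))%N.
    by lia.
  have -> : (2 * l.+2 + (J + N).+1 = 2 * l + 5 + J + N)%N by lia.
  have -> : ((J + N).+1 - (J.+1 + i) = N - i)%N by lia.
  have -> : (J.+1 + i)%:R + 2 * 1 = (J.+1 + i).+1.+1%:R :> F.
    by rewrite mulr1 -natrD addn2.
  rewrite poch_natS (factSr _ (J.+1 + i)).
  have -> : ((J.+1 + i).+1 + J.+1 = 2 * J + 3 + i)%N by lia.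
  have -> : (J.+1 + i)%:R + 1 = (J.+1 + i).+1%:R :> F by rewrite natr1.
  rewrite /K.
  have : (J.+1 + i).+1%:R != 0 :> F by rewrite pnatr_eq0.
  move: (factr_neq0 F (J.+1 + i)) (factr_neq0 F i) (factr_neq0 F (N - i)).
  move: (factr_neq0 F (2 * l + 5 + J + N)).
  move: (_ `!%:R) (_ `!%:R) (_ `!%:R) (_ `!%:R) (_.+1%:R)
    => f1 f2 f3 f4 s h1 h2 h3 h4 h5.
  by field; rewrite ?h1 ?h2 ?h3 ?h4 ?h5.
rewrite sum_fact_convolution.
rewrite (@poch_half_pair _ (2 * l + 3)); last first.
  by rewrite -natrM; congr (_%:R); lia.
(* Duplication at [x = 1], since [j!] is [(1)_j]. *)
have -> : poch (1 / 2 + 1) J.+1 * J.+1`!%:R = (2 * J + 3)`!%:R / 4 ^+ J.+1 :> F.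
  have := @poch_half_pair 1 1 J.+1 (mulr1 2).
  rewrite addrC [poch 1 _](poch_natS F 0) add0n fact0 !divr1 mulrC => ->.
  by congr (_`!%:R / _); lia.
have -> : 2 * l.+2%:R + 2 * 1 + (J + N)%:R = (2 * l + 5 + J + N).+1%:R :> F.
  by rewrite mulr1 -natrM -!natrD; congr (_%:R); lia.
rewrite poch_oppn poch_natS.
have -> : ((2 * J + 3 + (2 * l + 1) + N).+1 = 2 * l + 5 + J + N + J)%N by lia.
have -> : ((2 * J + 3 + (2 * l + 1)).+1 = 2 * l + 3 + 2 * J.+1)%N by lia.
have -> : (2 * l + 3)`!%:R = (2 * l%:R + 3) * (2 * l%:R + 2) * (2 * l + 1)`!%:R :> F.
  have -> : (2 * l + 3 = (2 * l + 1).+2)%N by lia.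
  rewrite (factSr F (2 * l + 1).+1) (factSr F (2 * l + 1)) mulrA.
  by congr (_ * _ * _); rewrite -natrM -natrD; congr (_%:R); lia.
have : 2 * l%:R + 3 != 0 :> F by rewrite -natrM -natrD pnatr_eq0 addn3.
have : 2 * l%:R + 2 != 0 :> F by rewrite -natrM -natrD pnatr_eq0 addn2.
have : l.+2%:R = l%:R + 2 :> F by rewrite -addn2 natrD.
have : (J + N).+1%:R = (J + N)%:R + 1 :> F by rewrite natr1.
rewrite /K exprS => -> ->.
move: (expr4_neq0 J.+1) (factr_neq0 F N) (factr_neq0 F (2 * l + 1)).
move: (factr_neq0 F (2 * l + 5 + J + N)) (factr_neq0 F (2 * l + 3 + 2 * J.+1)).
move: (_ `!%:R) (_ `!%:R) (_ `!%:R) (_ `!%:R) (_ ^+ J.+1) (J + N)%:R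
  => f1 f2 f3 f4 x s h1 h2 h3 h4 h5 h6 h7.
by field; rewrite ?h1 ?h2 ?h3 ?h4 ?h5 ?h6 ?h7.
Qed.

(** Now [(k + 1)_(J+1) = (k + J + 1)!/k!] already cancels [k!], so the factor
    [2 (k + 1/2) = 2 i + 2 J + 3] stays and is the weight of [sum_fact_convolution_lin] for
    [2 J + 2]. *)
Lemma dual_coef_half_sum l J N :
  (\sum_(i < N.+1) dual_coef_half l.+2 (J + N).+1 (J.+1 + i)%N *
        (poch (- (J.+1 + i)%:R) J.+1 *
         poch ((J.+1 + i)%:R + 2 * (1 / 2)) J.+1))
      * (poch l.+2%:R J.+1 * poch (l.+2%:R + 1 / 2) J.+1)
    = - (2 * (l.+2%:R + 1 / 2 + (J + N)%:R) * poch (- (J + N)%:R) J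
         * poch (2 * l.+2%:R + 2 * (1 / 2) + (J + N)%:R) J)
      * (poch (1 / 2 + 1) J.+1 * J.+1`!%:R).
Proof.
have two0 : 2 != 0 :> F by rewrite pnatr_eq0.
have twoh : 2 * (1 / 2) = 1 :> F by rewrite mul1r divff.
pose K : F := (J + N)`!%:R * (2 * l.+2%:R - 2) * (2 * l.+2%:R - 1)
  / (2 * l + 4 + J + N)`!%:R * (-1) ^+ J.+1.
transitivity (K * (\sum_(i < N.+1)
   (i%:R *+ 2 + (2 * J + 2).+1%:R) * (2 * J + 2 + i)`!%:R / i`!%:R *
    ((2 * l + 1 + (N - i))`!%:R / (N - i)`!%:R)) *
   (poch l.+2%:R J.+1 * poch (l.+2%:R + 1 / 2) J.+1)).
  congr (_ * _); rewrite mulr_sumr; apply: eq_bigr => i _.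
  have iN : (i <= N)%N by rewrite -ltnS.
  rewrite /dual_coef_half poch_oppn twoh natr1 poch_natS.
  have -> : ((J + N).+1 - 1 = J + N)%N by lia.
  have -> : (2 * l.+2 + (J + N).+1 - (J.+1 + i) - 3 = 2 * l + 1 + (N - i))%N.
    by lia.
  have -> : (2 * l.+2 + (J + N).+1 - 1 = 2 * l + 4 + J + N)%N by lia.
  have -> : ((J + N).+1 - (J.+1 + i) = N - i)%N by lia.
  have -> : (J.+1 + i + J.+1 = 2 * J + 2 + i)%N by lia.
  have -> : (2 * J + 2).+1%:R = 2 * J%:R + 3 :> F.
    by rewrite -natrM -natrD; congr (_%:R); lia.
  have -> : (J.+1 + i)%:R = J%:R + i%:R + 1 :> F.
    by rewrite addSn -natr1 natrD.
  rewrite /K.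
  move: (factr_neq0 F (J.+1 + i)) (factr_neq0 F i) (factr_neq0 F (N - i)).
  move: (factr_neq0 F (2 * l + 4 + J + N)).
  move: (_ `!%:R) (_ `!%:R) (_ `!%:R) (_ `!%:R)
    => f1 f2 f3 f4 h1 h2 h3 h4.
  by field; rewrite ?h1 ?h2 ?h3 ?h4.
rewrite sum_fact_convolution_lin.
rewrite (@poch_half_pair _ (2 * l + 3)); last first.
  by rewrite -natrM; congr (_%:R); lia.
have -> : poch (1 / 2 + 1) J.+1 * J.+1`!%:R = (2 * J + 3)`!%:R / 4 ^+ J.+1 :> F.
  have := @poch_half_pair 1 1 J.+1 (mulr1 2).
  rewrite addrC [poch 1 _](poch_natS F 0) add0n fact0 !divr1 mulrC => ->.
  by congr (_`!%:R / _); lia.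
have -> : 2 * l.+2%:R + 2 * (1 / 2) + (J + N)%:R = (2 * l + 4 + J + N).+1%:R :> F.
  by rewrite twoh -natrM natr1 -natrD; congr (_%:R); lia.
rewrite poch_oppn poch_natS.
have -> : ((2 * J + 2 + (2 * l + 1) + N).+1 = 2 * l + 4 + J + N + J)%N by lia.
have -> : ((2 * J + 2 + (2 * l + 1)).+2 = 2 * l + 3 + 2 * J.+1)%N by lia.
have -> : ((2 * J + 2).+1 = 2 * J + 3)%N by lia.
have -> : (2 * l + 3)`!%:R = (2 * l%:R + 3) * (2 * l%:R + 2) * (2 * l + 1)`!%:R :> F.
  have -> : (2 * l + 3 = (2 * l + 1).+2)%N by lia.
  rewrite (factSr F (2 * l + 1).+1) (factSr F (2 * l + 1)) mulrA.
  by congr (_ * _ * _); rewrite -natrM -natrD; congr (_%:R); lia.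
have : 2 * l%:R + 3 != 0 :> F by rewrite -natrM -natrD pnatr_eq0 addn3.
have : 2 * l%:R + 2 != 0 :> F by rewrite -natrM -natrD pnatr_eq0 addn2.
have -> : l.+2%:R = l%:R + 2 :> F by rewrite -addn2 natrD.
rewrite /K exprS.
move: (expr4_neq0 J.+1) (factr_neq0 F N) (factr_neq0 F (2 * l + 1)).
move: (factr_neq0 F (2 * l + 4 + J + N)) (factr_neq0 F (2 * l + 3 + 2 * J.+1)).
move: (_ `!%:R) (_ `!%:R) (_ `!%:R) (_ `!%:R) (_ ^+ J.+1)
  => f1 f2 f3 f4 x h1 h2 h3 h4 h5 h6 h7.
by field; rewrite ?h1 ?h2 ?h3 ?h4 ?h5 ?h6 ?h7.
Qed.

(** Here [(k)_(J+1) = (k + J)!/(k - 1)!] meets the [k!] of [(-k)_(J+1)] and leaves a factor [k].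
    Doubled, it is the weight [2 i + 2 J + 2] of the linear convolution for [2 J + 1]. *)
Lemma dual_coef0_sum l J N :
  (\sum_(i < N.+1) dual_coef0 l.+2 (J + N).+1 (J.+1 + i)%N *
        (poch (- (J.+1 + i)%:R) J.+1 *
         poch ((J.+1 + i)%:R + 2 * 0) J.+1))
      * (poch l.+2%:R J.+1 * poch (l.+2%:R + - (1 / 2)) J.+1)
    = - (2 * (l.+2%:R + 0 + (J + N)%:R) * poch (- (J + N)%:R) J
         * poch (2 * l.+2%:R + 2 * 0 + (J + N)%:R) J)
      * (poch (- (1 / 2) + 1) J.+1 * J.+1`!%:R).
Proof.
have two0 : 2 != 0 :> F by rewrite pnatr_eq0.
pose K : F := (J + N)`!%:R * (2 * l.+2%:R - 2)
  / (2 * l + 3 + J + N)`!%:R * (-1) ^+ J.+1.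
transitivity (K * (\sum_(i < N.+1)
   (i%:R *+ 2 + (2 * J + 1).+1%:R) * (2 * J + 1 + i)`!%:R / i`!%:R *
    ((2 * l + 1 + (N - i))`!%:R / (N - i)`!%:R)) *
   (poch l.+2%:R J.+1 * poch (l.+2%:R + - (1 / 2)) J.+1)).
  congr (_ * _); rewrite mulr_sumr; apply: eq_bigr => i _.
  have iN : (i <= N)%N by rewrite -ltnS.
  rewrite /dual_coef0 poch_oppn mulr0 addr0 addSn poch_natS (factSr F (J + i)).
  have -> : ((J + N).+1 - 1 = J + N)%N by lia.
  have -> : (2 * l.+2 + (J + N).+1 - (J + i).+1 - 3 = 2 * l + 1 + (N - i))%N.
    by lia.
  have -> : (2 * l.+2 + (J + N).+1 - 2 = 2 * l + 3 + J + N)%N by lia.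
  have -> : ((J + N).+1 - (J + i).+1 = N - i)%N by lia.
  have -> : (J + i + J.+1 = 2 * J + 1 + i)%N by lia.
  have -> : (2 * J + 1).+1%:R = 2 * J%:R + 2 :> F.
    by rewrite -natrM -natrD; congr (_%:R); lia.
  have -> : (J + i).+1%:R = J%:R + i%:R + 1 :> F by rewrite -natr1 natrD.
  rewrite /K.
  move: (factr_neq0 F (J + i)) (factr_neq0 F i) (factr_neq0 F (N - i)).
  move: (factr_neq0 F (2 * l + 3 + J + N)).
  move: (_ `!%:R) (_ `!%:R) (_ `!%:R) (_ `!%:R)
    => f1 f2 f3 f4 h1 h2 h3 h4.
  by field; rewrite ?h1 ?h2 ?h3 ?h4.
rewrite sum_fact_convolution_lin.
have -> : poch l.+2%:R J.+1 * poch (l.+2%:R + - (1 / 2)) J.+1 =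
    (2 * l + 2 + 2 * J.+1)`!%:R / (2 * l + 2)`!%:R / 4 ^+ J.+1 :> F.
  (* As [a] is negative, the lower member of the pair is [L - 1/2] and the upper one is [L]. *)
  rewrite -(@poch_half_pair (l.+2%:R + - (1 / 2))) ?subrK 1?mulrC //.
  rewrite mulrBl mulrVK ?unitfE // -natrM.
  by apply/eqP; rewrite subr_eq natr1; apply/eqP; congr (_%:R); lia.
have -> : poch (- (1 / 2) + 1) J.+1 * J.+1`!%:R = (2 * J + 2)`!%:R / 4 ^+ J.+1 :> F.
  have half2 : 1 / 2 + 1 / 2 = 1 :> F by field.
  have -> : - (1 / 2) + 1 = 1 / 2 :> F by field.
  have := @poch_half_pair (1 / 2) 0 J.+1; rewrite half2 mul1r divff // => /(_ erefl).
  rewrite [poch 1 _](poch_natS F 0) !add0n fact0 !divr1 => ->.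
  by congr (_`!%:R / _); lia.
have -> : 2 * l.+2%:R + 2 * 0 + (J + N)%:R = (2 * l + 3 + J + N).+1%:R :> F.
  by rewrite mulr0 addr0 -natrM -!natrD; congr (_%:R); lia.
rewrite poch_oppn poch_natS.
have -> : ((2 * J + 1 + (2 * l + 1) + N).+1 = 2 * l + 3 + J + N + J)%N by lia.
have -> : ((2 * J + 1 + (2 * l + 1)).+2 = 2 * l + 2 + 2 * J.+1)%N by lia.
have -> : ((2 * J + 1).+1 = 2 * J + 2)%N by lia.
have -> : (2 * l + 2)`!%:R = (2 * l%:R + 2) * (2 * l + 1)`!%:R :> F.
  have -> : (2 * l + 2 = (2 * l + 1).+1)%N by lia.
  rewrite (factSr F (2 * l + 1)).
  by congr (_ * _); rewrite -natrM -natrD; congr (_%:R); lia.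
have : 2 * l%:R + 2 != 0 :> F by rewrite -natrM -natrD pnatr_eq0 addn2.
have -> : l.+2%:R = l%:R + 2 :> F by rewrite -addn2 natrD.
rewrite /K exprS.
move: (expr4_neq0 J.+1) (factr_neq0 F N) (factr_neq0 F (2 * l + 1)).
move: (factr_neq0 F (2 * l + 3 + J + N)) (factr_neq0 F (2 * l + 2 + 2 * J.+1)).
move: (_ `!%:R) (_ `!%:R) (_ `!%:R) (_ `!%:R) (_ ^+ J.+1)
  => f1 f2 f3 f4 x h1 h2 h3 h4 h5 h6.
by field; rewrite ?h1 ?h2 ?h3 ?h4 ?h5 ?h6.
Qed.

(** * The equations of index [j = 0], which determine the coefficient of [g_0] *)

Lemma addr_natS_neq0 (x : F) k : 0 <= x -> x + k.+1%:R != 0.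
Proof. by move=> x0; rewrite gt_eqF // ltr_wpDl // ltr0n. Qed.

(** As [k + 1 = (1 + k)!/k!], the sum over all [0 <= k <= m] is a convolution. Its term at [k = 0]
    is not the coefficient of [g_0] but only the value of the formula there, and it is subtracted
    again. *)
Lemma dual_coef1_sum0 l n :
  - (2 * (n.+1%:R + 4 * l.+2%:R - 3) * (l.+2%:R + n.+1%:R)
       / ((2 * l.+2%:R + n.+1%:R) * (2 * l.+2%:R + n.+1%:R - 1)
                * (2 * l.+2%:R + n.+1%:R - 2)))
  + \sum_(i < n.+1) dual_coef1 l.+2 n.+1 i.+1 = 0.
Proof.
pose K : F := 2 * n`!%:R * (2 * l.+2%:R - 2) * (2 * l.+2%:R - 1)
  * (l.+2%:R + n.+1%:R) / (2 * l + 2 + n).+3`!%:R.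
have yE k : (k <= n.+1)%N -> dual_coef1 l.+2 n.+1 k =
    K * ((1 + k)`!%:R / k`!%:R *
      ((2 * l + 1 + (n.+1 - k))`!%:R / (n.+1 - k)`!%:R)).
  move=> kn; rewrite /dual_coef1.
  have -> : (n.+1 - 1 = n)%N by lia.
  have -> : (2 * l.+2 + n.+1 - k - 3 = 2 * l + 1 + (n.+1 - k))%N by lia.
  have -> : (2 * l.+2 + n.+1 = (2 * l + 2 + n).+3)%N by lia.
  rewrite add1n (factSr F k) -natr1 /K.
  move: (factr_neq0 F k) (factr_neq0 F (n.+1 - k)).
  move: (factr_neq0 F (2 * l + 2 + n).+3).
  move: (_ `!%:R) (_ `!%:R) (_ `!%:R) => f1 f2 f3 h1 h2 h3.
  by field; rewrite ?h1 ?h2 ?h3.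
rewrite (sum_ord_tail (dual_coef1 l.+2 n.+1)).
have -> : \sum_(k < n.+2) dual_coef1 l.+2 n.+1 k = \sum_(k < n.+2)
    K * ((1 + k)`!%:R / k`!%:R *
      ((2 * l + 1 + (n.+1 - k))`!%:R / (n.+1 - k)`!%:R)).
  by apply: eq_bigr => k _; rewrite yE // -ltnS.
rewrite yE // -mulr_sumr sum_fact_convolution !addn0 subn0 !fact0 /K.
have -> : (2 * l + 1 + n.+1 = 2 * l + 2 + n)%N by lia.
have -> : ((1 + (2 * l + 1) + n.+1).+1 = (2 * l + 2 + n).+2)%N by lia.
have -> : ((1 + (2 * l + 1)).+1 = (2 * l + 1).+2)%N by lia.
rewrite (factSr F (2 * l + 2 + n).+2) (factSr F (2 * l + 2 + n).+1).
rewrite (factSr F (2 * l + 2 + n)) (factSr F n).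
rewrite (factSr F (2 * l + 1).+1) (factSr F (2 * l + 1)).
have -> : (2 * l + 2 + n).+3%:R = 2 * l%:R + n%:R + 5 :> F.
  by rewrite -natrM -!natrD; congr (_%:R); lia.
have -> : (2 * l + 2 + n).+2%:R = 2 * l%:R + n%:R + 4 :> F.
  by rewrite -natrM -!natrD; congr (_%:R); lia.
have -> : (2 * l + 2 + n).+1%:R = 2 * l%:R + n%:R + 3 :> F.
  by rewrite -natrM -!natrD; congr (_%:R); lia.
have -> : (2 * l + 1).+2%:R = 2 * l%:R + 3 :> F.
  by rewrite -natrM -!natrD; congr (_%:R); lia.
have -> : (2 * l + 1).+1%:R = 2 * l%:R + 2 :> F.
  by rewrite -natrM -!natrD; congr (_%:R); lia.
have -> : n.+1%:R = n%:R + 1 :> F by rewrite natr1.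
have -> : l.+2%:R = l%:R + 2 :> F by rewrite -addn2 natrD.
have l0 : 0 <= 2 * l%:R :> F by rewrite -natrM ler0n.
have ln0 : 0 <= 2 * l%:R + n%:R :> F by rewrite addr_ge0 ?ler0n.
have h1 := addr_natS_neq0 2%N ln0; have h2 := addr_natS_neq0 3%N ln0.
have h3 := addr_natS_neq0 4%N ln0.
have h4 := addr_natS_neq0 1%N l0; have h5 := addr_natS_neq0 2%N l0.
have h6 := addr_natS_neq0 0%N (ler0n F n).
move: (factr_neq0 F n) (factr_neq0 F (2 * l + 1)) (factr_neq0 F (2 * l + 2 + n)).
have -> : 1`!%:R = 1 :> F by [].
move: h1 h2 h3 h4 h5 h6.
move: (_ `!%:R) (_ `!%:R) (_ `!%:R) => f1 f2 f3 h1 h2 h3 h4 h5 h6 h7 h8 h9.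
by field; rewrite h1 h2 h3 h4 h5 h6 h7 h8 h9.
Qed.

(** The sum is again completed by a term at [k = 0]; the factor [2 k + 1] is the weight of the
    linear convolution with first parameter 0. *)
Lemma dual_coef_half_sum0 l n :
  - ((2 * n.+1%:R + 6 * l.+2%:R - 5)
       / ((2 * l.+2%:R + n.+1%:R - 1) * (2 * l.+2%:R + n.+1%:R - 2)))
  + \sum_(i < n.+1) dual_coef_half l.+2 n.+1 i.+1 = 0.
Proof.
have two0 : 2 != 0 :> F by rewrite pnatr_eq0.
pose K : F := n`!%:R * (2 * l.+2%:R - 2) * (2 * l.+2%:R - 1)
  / (2 * l + 2 + n).+2`!%:R.
have yE k : (k <= n.+1)%N -> dual_coef_half l.+2 n.+1 k =
    K * ((k%:R *+ 2 + 1%:R) * (0 + k)`!%:R / k`!%:R *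
      ((2 * l + 1 + (n.+1 - k))`!%:R / (n.+1 - k)`!%:R)).
  move=> kn; rewrite /dual_coef_half.
  have -> : (n.+1 - 1 = n)%N by lia.
  have -> : (2 * l.+2 + n.+1 - k - 3 = 2 * l + 1 + (n.+1 - k))%N by lia.
  have -> : (2 * l.+2 + n.+1 - 1 = (2 * l + 2 + n).+2)%N by lia.
  rewrite add0n /K.
  move: (factr_neq0 F k) (factr_neq0 F (n.+1 - k)).
  move: (factr_neq0 F (2 * l + 2 + n).+2).
  move: (_ `!%:R) (_ `!%:R) (_ `!%:R) => f1 f2 f3 h1 h2 h3.
  by field; rewrite ?h1 ?h2 ?h3.
rewrite (sum_ord_tail (dual_coef_half l.+2 n.+1)).
have -> : \sum_(k < n.+2) dual_coef_half l.+2 n.+1 k = \sum_(k < n.+2)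
    K * ((k%:R *+ 2 + 1%:R) * (0 + k)`!%:R / k`!%:R *
      ((2 * l + 1 + (n.+1 - k))`!%:R / (n.+1 - k)`!%:R)).
  by apply: eq_bigr => k _; rewrite yE // -ltnS.
rewrite yE // -mulr_sumr sum_fact_convolution_lin !addn0 !add0n subn0 !fact0 /K.
have -> : (2 * l + 1 + n.+1 = 2 * l + 2 + n)%N by lia.
rewrite (factSr F (2 * l + 2 + n).+1).
rewrite (factSr F (2 * l + 2 + n)) (factSr F n).
rewrite (factSr F (2 * l + 1).+1) (factSr F (2 * l + 1)).
have -> : (2 * l + 2 + n).+2%:R = 2 * l%:R + n%:R + 4 :> F.
  by rewrite -natrM -!natrD; congr (_%:R); lia.
have -> : (2 * l + 2 + n).+1%:R = 2 * l%:R + n%:R + 3 :> F.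
  by rewrite -natrM -!natrD; congr (_%:R); lia.
have -> : (2 * l + 1).+2%:R = 2 * l%:R + 3 :> F.
  by rewrite -natrM -!natrD; congr (_%:R); lia.
have -> : (2 * l + 1).+1%:R = 2 * l%:R + 2 :> F.
  by rewrite -natrM -!natrD; congr (_%:R); lia.
have -> : n.+1%:R = n%:R + 1 :> F by rewrite natr1.
have -> : l.+2%:R = l%:R + 2 :> F by rewrite -addn2 natrD.
have l0 : 0 <= 2 * l%:R :> F by rewrite -natrM ler0n.
have ln0 : 0 <= 2 * l%:R + n%:R :> F by rewrite addr_ge0 ?ler0n.
have h1 := addr_natS_neq0 2%N ln0; have h2 := addr_natS_neq0 3%N ln0.
have h4 := addr_natS_neq0 1%N l0; have h5 := addr_natS_neq0 2%N l0.
have h6 := addr_natS_neq0 0%N (ler0n F n).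
move: (factr_neq0 F n) (factr_neq0 F (2 * l + 1)) (factr_neq0 F (2 * l + 2 + n)).
have -> : 1`!%:R = 1 :> F by [].
move: h1 h2 h4 h5 h6.
move: (_ `!%:R) (_ `!%:R) (_ `!%:R) => f1 f2 f3 h1 h2 h4 h5 h6 h7 h8 h9.
by field; rewrite ?h1 ?h2 ?h4 ?h5 ?h6 ?h7 ?h8 ?h9 ?two0.
Qed.

(** No factor grows with [k] here, so the sum over [k >= 1] is itself a convolution in [i = k - 1],
    and no term has to be added. *)
Lemma dual_coef0_sum0 l n :
  - (2 / (2 * l.+2%:R + n.+1%:R - 2))
  + \sum_(i < n.+1) dual_coef0 l.+2 n.+1 i.+1 = 0.
Proof.
pose K : F := 2 * n`!%:R * (2 * l.+2%:R - 2) / (2 * l + 2 + n).+1`!%:R.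
have -> : \sum_(i < n.+1) dual_coef0 l.+2 n.+1 i.+1 = \sum_(i < n.+1)
    K * ((0 + i)`!%:R / i`!%:R * ((2 * l + 1 + (n - i))`!%:R / (n - i)`!%:R)).
  apply: eq_bigr => i _; have iN : (i <= n)%N by rewrite -ltnS.
  rewrite /dual_coef0 add0n divff ?factr_neq0 // mul1r.
  have -> : (n.+1 - 1 = n)%N by lia.
  have -> : (2 * l.+2 + n.+1 - i.+1 - 3 = 2 * l + 1 + (n - i))%N by lia.
  have -> : (2 * l.+2 + n.+1 - 2 = (2 * l + 2 + n).+1)%N by lia.
  rewrite subSS /K.
  move: (factr_neq0 F (n - i)) (factr_neq0 F (2 * l + 2 + n).+1).
  move: (_ `!%:R) (_ `!%:R) => f1 f2 h1 h2.
  by field; rewrite ?h1 ?h2.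
rewrite -mulr_sumr sum_fact_convolution !add0n fact0 /K.
have -> : ((2 * l + 1 + n).+1 = 2 * l + 2 + n)%N by lia.
rewrite (factSr F (2 * l + 2 + n)) (factSr F (2 * l + 1)).
have -> : (2 * l + 2 + n).+1%:R = 2 * l%:R + n%:R + 3 :> F.
  by rewrite -natrM -!natrD; congr (_%:R); lia.
have -> : (2 * l + 1).+1%:R = 2 * l%:R + 2 :> F.
  by rewrite -natrM -!natrD; congr (_%:R); lia.
have -> : n.+1%:R = n%:R + 1 :> F by rewrite natr1.
have -> : l.+2%:R = l%:R + 2 :> F by rewrite -addn2 natrD.
have l0 : 0 <= 2 * l%:R :> F by rewrite -natrM ler0n.
have ln0 : 0 <= 2 * l%:R + n%:R :> F by rewrite addr_ge0 ?ler0n.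
have := addr_natS_neq0 2%N ln0; have := addr_natS_neq0 1%N l0.
move: (factr_neq0 F n) (factr_neq0 F (2 * l + 1)) (factr_neq0 F (2 * l + 2 + n)).
move: (_ `!%:R) (_ `!%:R) (_ `!%:R) => f1 f2 f3 h1 h2 h3 h4 h5.
by field; rewrite ?h1 ?h2 ?h3 ?h4 ?h5.
Qed.

End ThreeCases.

Unset Implicit Arguments.

Theorem theorem7p1 (R : realType) (L : nat) (hL : (2 <= L)%N) :
  (forall m k : nat, (1 <= k)%N -> (k <= m)%N ->
    [/\ Ecoef m k (1 / 2 : R) 1 L =
          2 * (k%:R + 1) * (m - 1)`!%:R * (2 * L%:R - 2) * (2 * L%:R - 1)
            * (L%:R + m%:R) * (2 * L + m - k - 3)`!%:R
          / ((m - k)`!%:R * (2 * L + m)`!%:R),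
        Ecoef m k (1 / 2 : R) (1 / 2) L =
          2 * (k%:R + 1 / 2) * (m - 1)`!%:R * (2 * L%:R - 2) * (2 * L%:R - 1)
            * (2 * L + m - k - 3)`!%:R
          / ((m - k)`!%:R * (2 * L + m - 1)`!%:R)
      & Ecoef m k (- (1 / 2) : R) 0 L =
          2 * (m - 1)`!%:R * (2 * L%:R - 2) * (2 * L + m - k - 3)`!%:R
          / ((m - k)`!%:R * (2 * L + m - 2)`!%:R)])
  /\
  (forall m : nat, (1 <= m)%N ->
    [/\ Ecoef m 0 (1 / 2 : R) 1 L =
          - (2 * (m%:R + 4 * L%:R - 3) * (L%:R + m%:R)
             / ((2 * L%:R + m%:R) * (2 * L%:R + m%:R - 1)
                * (2 * L%:R + m%:R - 2))),
        Ecoef m 0 (1 / 2 : R) (1 / 2) L =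
          - ((2 * m%:R + 6 * L%:R - 5)
             / ((2 * L%:R + m%:R - 1) * (2 * L%:R + m%:R - 2)))
      & Ecoef m 0 (- (1 / 2) : R) 0 L =
          - (2 / (2 * L%:R + m%:R - 2))]).
Proof.
have half : real_complex R (1 / 2) = 1 / 2.
  by rewrite fmorph_div rmorph1 rmorph_nat.
have one : real_complex R 1 = 1 by rewrite rmorph1.
have zero : real_complex R 0 = 0 by rewrite rmorph0.
have nhalf : real_complex R (- (1 / 2)) = - (1 / 2) by rewrite rmorphN /= half.
have half_gt0 : 0 < 1 / 2 :> R by rewrite divr_gt0.
have a1 : -1 < 1 / 2 :> R by rewrite (lt_trans _ half_gt0) // oppr_lt0.
have a2 : -1 < - (1 / 2) :> R.
  by rewrite ltrN2 ltr_pdivrMr // mul1r ltr1n.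
case: L hL => [|[|l]] // _.
(* Supplying the equation [j = 0] fixes [c0] and the family [y] by unification; only the equations
   with [j >= 1] remain as a premise. *)
have E1 n := Ecoef_of_sums (n := n) a1 ler01 (isT : (1 <= l.+2)%N)
  (dual_coef1_sum0 _ l n).
have E2 n := Ecoef_of_sums (n := n) a1 (ltW half_gt0) (isT : (1 <= l.+2)%N)
  (dual_coef_half_sum0 _ l n).
have E3 n := Ecoef_of_sums (n := n) a2 (lexx 0) (isT : (1 <= l.+2)%N)
  (dual_coef0_sum0 _ l n).
rewrite one half in E1; rewrite half in E2; rewrite nhalf zero in E3.
split=> [m k k1 km|[|n] // _].
- case: m km => [|n] kn; first by have := leq_trans k1 kn.
  have kn' : (1 <= k <= n.+1)%N by rewrite k1.
  split; [have [|_ /(_ k kn')->//] := E1 n | have [|_ /(_ k kn')->//] := E2 n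
         | have [|_ /(_ k kn')->//] := E3 n] => J N ->.
  + exact: dual_coef1_sum.
  + exact: dual_coef_half_sum.
  + exact: dual_coef0_sum.
split; [have [|-> _ //] := E1 n | have [|-> _ //] := E2 n
       | have [|-> _ //] := E3 n] => J N ->.
+ exact: dual_coef1_sum.
+ exact: dual_coef_half_sum.
+ exact: dual_coef0_sum.
Qed.
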